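(* Let $n\ge 0$, let $\mathbf{k}$ be a field and $q\in\mathbf{k}$. Then the elements $\mathcal{R}_{n,k}\in\mathcal{H}_n$ for all $k\ge 0$ pairwise commute: $\mathcal{R}_{n,i}\mathcal{R}_{n,j}=\mathcal{R}_{n,j}\mathcal{R}_{n,i}$ for all $i,j\ge 0$.
   Context: The Hecke algebra $\mathcal{H}_n$ (over a field $\mathbf{k}$, parameter $q\in\mathbf{k}$) is the unital associative $\mathbf{k}$-algebra generated by $T_1,\dots,T_{n-1}$ subject to $T_i^2=(q-1)T_i+q$, $T_iT_j=T_jT_i$ for $|i-j|>1$, and $T_iT_{i+1}T_i=T_{i+1}T_iT_{i+1}$. It has a basis $(T_w)_{w\in S_n}$, where $T_w=T_{i_1}\cdots T_{i_r}$ for any reduced expression $w=s_{i_1}\cdots s_{i_r}$ with $s_i=(i,i+1)$. We regard $\mathcal{H}_0\subseteq\mathcal{H}_1\subseteq\mathcal{H}_2\subseteq\cdots$ by identifying equally named generators. Let $[k]_q=1+q+\cdots+q^{k-1}$ and $[k]!_q=[1]_q[2]_q\cdots[k]_q$. For any integer $m$ set $\mathcal{B}_m=\sum_{i=1}^m T_{m-1}T_{m-2}\cdots T_i$ and $\mathcal{B}^*_m=\sum_{i=1}^m T_iT_{i+1}\cdots T_{m-1}$ (both are $0$ for $m\le 0$). For $n,k\ge0$ set $\mathcal{B}_{n,k}=\mathcal{B}_{n-k+1}\cdots\mathcal{B}_{n-1}\mathcal{B}_n$ and $\mathcal{B}^*_{n,k}=\mathcal{B}^*_n\mathcal{B}^*_{n-1}\cdots\mathcal{B}^*_{n-k+1}$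 (empty products equal $1$), and $\mathcal{R}_{n,k}=\frac{1}{[k]!_q}\mathcal{B}^*_{n,k}\mathcal{B}_{n,k}$. For an indeterminate $q$ the product $\mathcal{B}^*_{n,k}\mathcal{B}_{n,k}$ is a combination of the $T_w$ with coefficients in $\mathbb{Z}[q]$ divisible by $[k]!_q$; for a specific value of $q$, $\mathcal{R}_{n,k}$ is defined by specializing this quotient. *)

(* Defs.v *)
From HB Require Import structures.
From mathcomp Require Import all_boot all_order all_algebra generic_quotient.
From mathcomp Require Import boolp classical_sets.
Set Implicit Arguments. Unset Strict Implicit. Unset Printing Implicit Defensive.
Import GRing.Theory.
Local Open Scope ring_scope.
Local Open Scope quotient_scope.

(* Index set {1, ..., n-1} of the generators (empty for n = 0 and n = 1). *)
Definition hgen (n : nat) : Type := {i : nat | (0 < i < n)%N}.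

(* Formal expressions in the generators, with scalars from R. *)
Inductive hterm (R : Type) (n : nat) : Type :=
| HScal of R
| HGen of hgen n
| HAdd of hterm R n & hterm R n
| HMul of hterm R n & hterm R n.
Arguments HScal {R n}.
Arguments HGen {R n}.

HB.instance Definition _ (R : Type) (n : nat) := gen_eqMixin (hterm R n).
HB.instance Definition _ (R : Type) (n : nat) := gen_choiceMixin (hterm R n).

(* The smallest congruence that makes expressions a unital associative
   R-algebra and contains the defining relations of the Hecke algebra. *)
Inductive hequiv (R : comNzRingType) (q : R) (n : nat) :
    hterm R n -> hterm R n -> Prop :=
| heq_refl x : hequiv q x x
| heq_sym x y : hequiv q x y -> hequiv q y x
| heq_trans x y z : hequiv q x y -> hequiv q y z -> hequiv q x z
| heq_add x x' y y' :
    hequiv q x x' -> hequiv q y y' -> hequiv q (HAdd x y) (HAdd x' y')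
| heq_mul x x' y y' :
    hequiv q x x' -> hequiv q y y' -> hequiv q (HMul x y) (HMul x' y')
| heq_addA x y z : hequiv q (HAdd x (HAdd y z)) (HAdd (HAdd x y) z)
| heq_addC x y : hequiv q (HAdd x y) (HAdd y x)
| heq_add0 x : hequiv q (HAdd (HScal 0) x) x
| heq_mulA x y z : hequiv q (HMul x (HMul y z)) (HMul (HMul x y) z)
| heq_mul1 x : hequiv q (HMul (HScal 1) x) x
| heq_mul0 x : hequiv q (HMul (HScal 0) x) (HScal 0)
| heq_mulDl x y z : hequiv q (HMul (HAdd x y) z) (HAdd (HMul x z) (HMul y z))
| heq_mulDr x y z : hequiv q (HMul x (HAdd y z)) (HAdd (HMul x y) (HMul x z))
| heq_scalD a b : hequiv q (HScal (a + b)) (HAdd (HScal a) (HScal b))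
| heq_scalM a b : hequiv q (HScal (a * b)) (HMul (HScal a) (HScal b))
| heq_scalC a x : hequiv q (HMul (HScal a) x) (HMul x (HScal a))
| heq_quad i :
    hequiv q (HMul (HGen i) (HGen i))
             (HAdd (HMul (HScal (q - 1)) (HGen i)) (HScal q))
| heq_comm i j : ((val i).+1 < val j)%N ->
    hequiv q (HMul (HGen i) (HGen j)) (HMul (HGen j) (HGen i))
| heq_braid i j : val j = (val i).+1 ->
    hequiv q (HMul (HMul (HGen i) (HGen j)) (HGen i))
             (HMul (HMul (HGen j) (HGen i)) (HGen j)).

Definition hequivb (R : comNzRingType) (q : R) (n : nat) : rel (hterm R n) :=
  fun x y => `[< hequiv q x y >].

Lemma hequivb_refl (R : comNzRingType) (q : R) n : reflexive (@hequivb R q n).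
Proof. by move=> x; apply/asboolP/heq_refl. Qed.

Lemma hequivb_sym (R : comNzRingType) (q : R) n : symmetric (@hequivb R q n).
Proof. by move=> x y; apply/asboolP/asboolP; apply: heq_sym. Qed.

Lemma hequivb_trans (R : comNzRingType) (q : R) n : transitive (@hequivb R q n).
Proof.
by move=> y x z /asboolP xy /asboolP yz; apply/asboolP/(heq_trans xy yz).
Qed.

Canonical hequivb_equiv (R : comNzRingType) (q : R) n :=
  EquivRel (@hequivb R q n) (@hequivb_refl R q n) (@hequivb_sym R q n)
    (@hequivb_trans R q n).

(* The Hecke algebra with parameter q, over any nonzero commutative ring. *)
Definition hecke (R : comNzRingType) (q : R) (n : nat) : Type :=
  {eq_quot (@hequivb R q n)}.

HB.instance Definition _ (R : comNzRingType) (q : R) (n : nat) :=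
  Choice.on (hecke q n).
HB.instance Definition _ (R : comNzRingType) (q : R) (n : nat) :=
  EqQuotient.on (hecke q n).

Fixpoint heval (R : Type) (n : nat) (A : pzRingType) (f : R -> A)
    (t : hgen n -> A) (x : hterm R n) : A :=
  match x with
  | HScal a => f a
  | HGen i => t i
  | HAdd x y => heval f t x + heval f t y
  | HMul x y => heval f t x * heval f t y
  end.

Lemma heval_hequiv (R : comNzRingType) (q : R) (n : nat) (A : pzRingType)
    (f : {rmorphism R -> A}) (t : hgen n -> A)
    (fC : forall a x, f a * x = x * f a)
    (tquad : forall i, t i * t i = f (q - 1) * t i + f q)
    (tcomm : forall i j, ((val i).+1 < val j)%N -> t i * t j = t j * t i)
    (tbraid : forall i j, val j = (val i).+1 ->
       t i * t j * t i = t j * t i * t j)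
    (x y : hterm R n) :
  hequiv q x y -> heval f t x = heval f t y.
Proof.
elim=> //=.
- by move=> {}x {}y z _ -> _ ->.
- by move=> {}x x' {}y y' _ -> _ ->.
- by move=> {}x x' {}y y' _ -> _ ->.
- by move=> *; rewrite addrA.
- by move=> *; rewrite addrC.
- by move=> *; rewrite rmorph0 add0r.
- by move=> *; rewrite mulrA.
- by move=> *; rewrite rmorph1 mul1r.
- by move=> *; rewrite rmorph0 mul0r.
- by move=> *; rewrite mulrDl.
- by move=> *; rewrite mulrDr.
- by move=> *; rewrite rmorphD.
- by move=> *; rewrite rmorphM.
Qed.

Section HeckeStructure.
Variables (R : comNzRingType) (q : R) (n : nat).
Local Notation H := (hecke q n).

Lemma hecke_eqP (x y : hterm R n) :
  reflect (hequiv q x y) (\pi_H x == \pi_H y).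
Proof. by rewrite eqmodE; apply: asboolP. Qed.

Definition hscal (a : R) : H := \pi_H (HScal a).
Definition hadd (x y : H) : H := \pi_H (HAdd (repr x) (repr y)).
Definition hmul (x y : H) : H := \pi_H (HMul (repr x) (repr y)).

Lemma hrepr_pi (x : hterm R n) : hequiv q (repr (\pi_H x)) x.
Proof. by apply/hecke_eqP; rewrite reprK. Qed.

Lemma pi_hadd (x y : hterm R n) : \pi_H (HAdd x y) = hadd (\pi_H x) (\pi_H y).
Proof. by apply/eqP/hecke_eqP/heq_sym/heq_add; apply: hrepr_pi. Qed.

Lemma pi_hmul (x y : hterm R n) : \pi_H (HMul x y) = hmul (\pi_H x) (\pi_H y).
Proof. by apply/eqP/hecke_eqP/heq_sym/heq_mul; apply: hrepr_pi. Qed.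

Definition hopp (x : H) : H := hmul (hscal (-1)) x.

Lemma hecke_ind (P : H -> Prop) : (forall x, P (\pi_H x)) -> forall x, P x.
Proof. by move=> Ppi x; rewrite -[x]reprK. Qed.

Lemma hecke_pi_eq (x y : hterm R n) : hequiv q x y -> \pi_H x = \pi_H y.
Proof. by move=> /hecke_eqP/eqP. Qed.

Lemma haddA : associative hadd.
Proof.
elim/hecke_ind=> x; elim/hecke_ind=> y; elim/hecke_ind=> z.
by rewrite -!pi_hadd; apply/hecke_pi_eq/heq_addA.
Qed.

Lemma haddC : commutative hadd.
Proof.
elim/hecke_ind=> x; elim/hecke_ind=> y.
by rewrite -!pi_hadd; apply/hecke_pi_eq/heq_addC.
Qed.

Lemma hadd0 : left_id (hscal 0) hadd.
Proof. by elim/hecke_ind=> x; rewrite -pi_hadd; apply/hecke_pi_eq/heq_add0. Qed.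

Lemma hmulA : associative hmul.
Proof.
elim/hecke_ind=> x; elim/hecke_ind=> y; elim/hecke_ind=> z.
by rewrite -!pi_hmul; apply/hecke_pi_eq/heq_mulA.
Qed.

Lemma hmul1l : left_id (hscal 1) hmul.
Proof. by elim/hecke_ind=> x; rewrite -pi_hmul; apply/hecke_pi_eq/heq_mul1. Qed.

Lemma hscalC a x : hmul (hscal a) x = hmul x (hscal a).
Proof.
by elim/hecke_ind: x => x; rewrite -!pi_hmul; apply/hecke_pi_eq/heq_scalC.
Qed.

Lemma hmul1r : right_id (hscal 1) hmul.
Proof. by move=> x; rewrite -hscalC hmul1l. Qed.

Lemma hmulDl : left_distributive hmul hadd.
Proof.
elim/hecke_ind=> x; elim/hecke_ind=> y; elim/hecke_ind=> z.
by rewrite -!(pi_hadd, pi_hmul); apply/hecke_pi_eq/heq_mulDl.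
Qed.

Lemma hmulDr : right_distributive hmul hadd.
Proof.
elim/hecke_ind=> x; elim/hecke_ind=> y; elim/hecke_ind=> z.
by rewrite -!(pi_hadd, pi_hmul); apply/hecke_pi_eq/heq_mulDr.
Qed.

Lemma hscalD a b : hscal (a + b) = hadd (hscal a) (hscal b).
Proof. by rewrite -pi_hadd; apply/hecke_pi_eq/heq_scalD. Qed.

Lemma hscalM a b : hscal (a * b) = hmul (hscal a) (hscal b).
Proof. by rewrite -pi_hmul; apply/hecke_pi_eq/heq_scalM. Qed.

Lemma haddN : left_inverse (hscal 0) hopp hadd.
Proof.
move=> x; rewrite /hopp -{2}[x]hmul1l -hmulDl -hscalD addNr.
by elim/hecke_ind: x => x; rewrite -pi_hmul; apply/hecke_pi_eq/heq_mul0.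
Qed.

HB.instance Definition _ := GRing.isZmodule.Build H haddA haddC hadd0 haddN.

(* T_i |-> q is a one-dimensional representation. *)
Lemma hecke_1_neq_0 : hscal 1 != 0 :> H.
Proof.
apply/hecke_eqP => /(@heval_hequiv _ _ _ _ idfun (fun=> q)) /= E.
have/eqP := oner_neq0 R; apply; apply: E => //.
- by move=> a x; rewrite mulrC.
- by move=> _; rewrite mulrBl mul1r subrK.
Qed.

HB.instance Definition _ := GRing.Zmodule_isNzRing.Build H
  hmulA hmul1l hmul1r hmulDl hmulDr hecke_1_neq_0.

Definition hscale (a : R) (x : H) : H := hscal a * x.

Lemma hscaleA a b x : hscale a (hscale b x) = hscale (a * b) x.
Proof. by rewrite /hscale mulrA; congr (_ * _); rewrite hscalM. Qed.

Lemma hscale1 : left_id 1 hscale.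
Proof. by move=> x; rewrite /hscale; apply: hmul1l. Qed.

Lemma hscaleDr : right_distributive hscale +%R.
Proof. by move=> a x y; rewrite /hscale mulrDr. Qed.

Lemma hscaleDl x : {morph hscale^~ x : a b / a + b}.
Proof. by move=> a b; rewrite /hscale -mulrDl; congr (_ * _); apply: hscalD. Qed.

HB.instance Definition _ := GRing.Zmodule_isLmodule.Build R H
  hscaleA hscale1 hscaleDr hscaleDl.

Lemma hscaleAl (a : R) (x y : H) : a *: (x * y) = (a *: x) * y.
Proof. exact: (mulrA (hscal a)). Qed.

HB.instance Definition _ := GRing.Lmodule_isLalgebra.Build R H hscaleAl.

Lemma hscaleAr (a : R) (x y : H) : a *: (x * y) = x * (a *: y).
Proof.
have comm_a : hscal a * x = x * hscal a by apply: hscalC.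
by rewrite /GRing.scale /= /hscale !mulrA comm_a.
Qed.

HB.instance Definition _ := GRing.Lalgebra_isAlgebra.Build R H hscaleAr.

(* T_i; the value 0 outside 0 < i < n is never used below. *)
Definition hT (i : nat) : H := oapp (fun g => \pi_H (HGen g)) 0 (insub i).

Lemma hT_gen (i : hgen n) : hT (val i) = \pi_H (HGen i).
Proof. by rewrite /hT valK. Qed.

Lemma hscalE (a : R) : hscal a = a%:A.
Proof. exact/esym/mulr1. Qed.

Lemma hT_quad i : (0 < i < n)%N -> hT i * hT i = (q - 1) *: hT i + q%:A.
Proof.
move=> ltin; pose g : hgen n := exist _ i ltin.
rewrite -[i]/(val g) hT_gen -hscalE.
have := hecke_pi_eq (heq_quad q g); by rewrite pi_hadd !pi_hmul.
Qed.

Lemma hT_comm i j : (0 < i)%N -> (i.+1 < j)%N -> (j < n)%N ->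
  hT i * hT j = hT j * hT i.
Proof.
move=> i_gt0 ltij ltjn.
have ltin : (0 < i < n)%N by rewrite i_gt0 (ltn_trans _ ltjn) // ltnW.
have ltj : (0 < j < n)%N by rewrite ltjn (leq_trans _ ltij).
pose g : hgen n := exist _ i ltin; pose h : hgen n := exist _ j ltj.
rewrite -[i]/(val g) -[j]/(val h) !hT_gen.
have := hecke_pi_eq (@heq_comm R q n g h ltij); by rewrite !pi_hmul.
Qed.

Lemma hT_braid i : (0 < i)%N -> (i.+1 < n)%N ->
  hT i * hT i.+1 * hT i = hT i.+1 * hT i * hT i.+1.
Proof.
move=> i_gt0 ltin.
have lti : (0 < i < n)%N by rewrite i_gt0 (ltn_trans _ ltin).
pose g : hgen n := exist _ i lti; pose h : hgen n := exist _ i.+1 ltin.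
rewrite -[i]/(val g) -[(val g).+1]/(val h) !hT_gen.
have := hecke_pi_eq (@heq_braid R q n g h erefl); by rewrite !pi_hmul.
Qed.

(* The index m is an integer since n - k + 1 may be negative in B_{n,k}. *)
Definition heckeB (m : int) : H :=
  if m is Posz m' then
    \sum_(1 <= i < m'.+1) \prod_(j <- rev (index_iota i m')) hT j
  else 0.

Definition heckeBstar (m : int) : H :=
  if m is Posz m' then \sum_(1 <= i < m'.+1) \prod_(i <= j < m') hT j
  else 0.

Definition heckeBprod (k : nat) : H :=
  \prod_(i < k) heckeB (n%:Z - k%:Z + 1 + i%:Z).

Definition heckeBstarprod (k : nat) : H :=
  \prod_(i < k) heckeBstar (n%:Z - i%:Z).

End HeckeStructure.

Definition qint (R : pzSemiRingType) (q : R) (k : nat) : R :=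
  \sum_(i < k) q ^+ i.

Definition qfact (R : pzSemiRingType) (q : R) (k : nat) : R :=
  \prod_(1 <= i < k.+1) qint q i.

(* The quotient of B*_{n,k} B_{n,k} by [k]!_q for an indeterminate q, i.e. in
   the Hecke algebra over Z[q].  As that algebra is free over Z[q] on the T_w,
   division by [k]!_q is coefficientwise and the quotient is unique; it exists
   because [k]!_q divides B*_{n,k} B_{n,k}, so the default 0 plays no role. *)
Definition heckeRgen (n k : nat) : hecke ('X : {poly int}) n :=
  xget 0 [set r | qfact ('X : {poly int}) k *: r =
                  heckeBstarprod 'X n k * heckeBprod 'X n k].

Section Specialization.
Variables (K : comNzRingType) (q : K) (n : nat).

Definition hspec_coef (p : {poly int}) : hecke q n :=
  ((map_poly (intr : int -> K) p).[q])%:A.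

Lemma hspec_coef_zmod : zmod_morphism hspec_coef.
Proof. by move=> x y; rewrite /hspec_coef rmorphB hornerD hornerN scalerBl. Qed.
Lemma hspec_coef_monoid : monoid_morphism hspec_coef.
Proof.
split=> [|x y]; rewrite /hspec_coef; first by rewrite rmorph1 hornerC scale1r.
by rewrite rmorphM hornerM -scalerAl mul1r scalerA.
Qed.
HB.instance Definition _ :=
  GRing.isZmodMorphism.Build {poly int} (hecke q n) hspec_coef hspec_coef_zmod.
HB.instance Definition _ :=
  GRing.isMonoidMorphism.Build {poly int} (hecke q n) hspec_coef
    hspec_coef_monoid.

(* The specialization of the indeterminate to q : K: replace every coefficient
   p by p.[q] and every T_i by T_i. *)
Definition hspec (x : hecke ('X : {poly int}) n) : hecke q n :=
  heval hspec_coef (fun i => hT q n (val i)) (repr x).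

Lemma hspec_pi (x : hterm {poly int} n) :
  hspec (\pi_(hecke ('X : {poly int}) n) x) =
  heval hspec_coef (fun i => hT q n (val i)) x.
Proof.
apply: (@heval_hequiv _ 'X); last exact: hrepr_pi.
- by move=> a y; rewrite -scalerAl -scalerAr mul1r mulr1.
- move=> i; rewrite hT_quad ?(valP i) // -scalerAl mul1r rmorphB rmorph1 /=.
  by rewrite /hspec_coef map_polyX !hornerE.
- move=> i j ltij; apply: hT_comm => //; first by case/andP: (valP i).
  by case/andP: (valP j).
- move=> i j eij; rewrite eij; apply: hT_braid; first by case/andP: (valP i).
  by rewrite -eij; case/andP: (valP j).
Qed.

Lemma hspec_zmod : zmod_morphism hspec.
Proof.
have hD : {morph hspec : x y / x + y}.
  by elim/hecke_ind=> x; elim/hecke_ind=> y; rewrite -[_ + _]pi_hadd !hspec_pi.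
move=> x y; apply: (addIr (hspec y)); by rewrite -hD !subrK.
Qed.

Lemma hspec_monoid : monoid_morphism hspec.
Proof.
split=> [|x y]; first by rewrite -[1]/(hscal 'X n 1) hspec_pi /= rmorph1.
elim/hecke_ind: x => x; elim/hecke_ind: y => y.
by rewrite -[_ * _]pi_hmul !hspec_pi.
Qed.

HB.instance Definition _ :=
  GRing.isZmodMorphism.Build (hecke ('X : {poly int}) n) (hecke q n) hspec
    hspec_zmod.
HB.instance Definition _ :=
  GRing.isMonoidMorphism.Build (hecke ('X : {poly int}) n) (hecke q n) hspec
    hspec_monoid.

Lemma hspecT i : hspec (hT 'X n i) = hT q n i.
Proof.
rewrite {1}/hT; case: insubP => [g _ <-|Ni] /=; first exact: hspec_pi.
by rewrite raddf0 /hT insubN.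
Qed.

Lemma hspecZ (p : {poly int}) x :
  hspec (p *: x) = (map_poly (intr : int -> K) p).[q] *: hspec x.
Proof.
rewrite -[p *: x]/(hscal 'X n p * x) rmorphM /= hspec_pi /=.
by rewrite /hspec_coef -scalerAl mul1r.
Qed.

Definition heckeR (k : nat) : hecke q n := hspec (heckeRgen n k).

End Specialization.

(* Main.v *)
Require Import Defs.
From Stdlib Require Import Ncring Ncring_tac.
From mathcomp Require Import all_boot all_order all_algebra.
From mathcomp Require Import zify generic_quotient boolp classical_sets.
Set Implicit Arguments.
Unset Strict Implicit.
Unset Printing Implicit Defensive.
Import GRing.Theory.
Local Open Scope ring_scope.

(** Write [P m k] for [B*_{m,k} B_{m,k}], so that
    [P m.+1 k.+1 = B*_{m+1} (P m k) B_{m+1}], and [L m] for [q ^ m] times the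
    Jucys-Murphy element of index [m]. From the relations
      [B_{m+1} B*_{m+1} = B*_m T_m B_m + [m+1]_q + L (m+1)] and
      [T_m B_m B_{m+1} = q B_m B_{m+1}]
    one gets, by induction on [k],
      [q^k B_{m+1} P_{m+1,k+1} = W B_{m+1}], where
      [W = q^(2k+1) P_{m,k+1} + [k+1]_q (q^k [m+1-k]_q + L (m+1)) P_{m,k}],
    and the mirror image of this identity under the anti-automorphism fixing the
    [T_i]. As [L (m+1)] commutes with [H_m], the element [W] commutes with all
    [P m i] once these commute with each other; hence [W] can be carried through
    [P_{m+1,i+1} = B*_{m+1} P_{m,i} B_{m+1}], and the [P_{m+1,i}] commute.

    It remains to divide by the [q]-factorials, for which [H_n] over [Z[q]] must
    be torsion-free: [H_{n+1}] embeds into [H_n ^ (n+1)], because the action of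
    the [T_j] on the basis [T_n T_{n-1} ... T_c] of [H_{n+1}] over [H_n] can be
    written down and checked to satisfy the Hecke relations. *)

(** * Noncommutative ring tactic *)

Section NoncommutativeRing.
Variable A : nzRingType.

#[global] Instance nzRing_ops :
  @Ring_ops A 0 1 +%R *%R (fun x y => x - y) -%R (@eq A) := {}.

#[global] Instance nzRing_ring : Ring (Ro := nzRing_ops).
Proof.
split.
- exact: eq_equivalence.
- by move=> x _ <- y _ <-.
- by move=> x _ <- y _ <-.
- by move=> x _ <- y _ <-.
- by move=> x _ <-.
- exact (@add0r A).
- exact (@addrC A).
- exact (@addrA A).
- exact (@mul1r A).
- exact (@mulr1 A).
- exact (@mulrA A).
- exact (@mulrDl A).
- by move=> x y z; exact (@mulrDr A z x y).
- by [].
- exact (@subrr A).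
Qed.

End NoncommutativeRing.

(** The tactic treats [q] and the [q]-integers as noncommuting atoms, so uses of centrality appear
    below as explicit rewrites between its calls. *)
Ltac ncring := rewrite ?expr0 ?exprS; non_commutative_ring.

(** * Shuffles in a ring with Hecke relations *)

Lemma qint0 (A : nzRingType) (q : A) : qint q 0 = 0.
Proof. exact: big_ord0. Qed.

Lemma qintS (A : nzRingType) (q : A) k : qint q k.+1 = 1 + q * qint q k.
Proof.
rewrite /qint big_ord_recl expr0 mulr_sumr; congr (_ + _).
by apply: eq_bigr => i _; rewrite -exprS.
Qed.

Lemma qintSr (A : nzRingType) (q : A) k : qint q k.+1 = qint q k + q ^+ k.
Proof. by rewrite /qint big_ord_recr. Qed.

Lemma qintD (A : nzRingType) (q : A) k l :
  qint q (k + l) = qint q k + q ^+ k * qint q l.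
Proof.
elim: k => [|k IHk]; first by rewrite qint0; ncring.
by rewrite addSn !qintS IHk; ncring.
Qed.

Lemma qint_comm (A : nzRingType) (q x : A) k :
  GRing.comm x q -> GRing.comm x (qint q k).
Proof. by move=> xq; apply: commr_sum => i _; apply: commrX. Qed.

(** Stated for an arbitrary ring instead of [hecke], so that results can also be read in the
    opposite ring; the parameter is therefore a central element. *)
Record hecke_rel (A : nzRingType) (q : A) (N : nat) (T : nat -> A) := HeckeRel {
  hecke_rel_central : forall x, GRing.comm x q;
  hecke_rel_quad : forall i, (0 < i < N)%N -> T i * T i = (q - 1) * T i + q;
  hecke_rel_comm : forall i j, (0 < i)%N -> (i.+1 < j)%N -> (j < N)%N ->
    GRing.comm (T i) (T j);
  hecke_rel_braid : forall i, (0 < i)%N -> (i.+1 < N)%N ->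
    T i * T i.+1 * T i = T i.+1 * T i * T i.+1 }.

(** Each relation is stable under reversal of products, [q] being central. Passing to [A^c] plays
    the part of the anti-automorphism fixing the generators. *)
Lemma hecke_rel_converse (A : nzRingType) (q : A) N (T : nat -> A) :
  hecke_rel q N T -> @hecke_rel A^c q N T.
Proof.
move=> [qC TQ TC TB]; split=> [x|i iN|i j i0 ij jN|i i0 iN].
- exact/esym/qC.
- rewrite [LHS](TQ i iN); congr (_ + _).
  exact/esym/(commrB (qC (T i)))/commr1.
- exact/esym/TC.
- by rewrite -[LHS]mulrA -[RHS]mulrA; apply: TB.
Qed.

Section Shuffles.
Variables (A : nzRingType) (q : A) (T : nat -> A).

(** The recursion $B_{m+1} = 1 + T_m B_m$. As it starts from [0], the value [T 0] never
    contributes. *)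
Fixpoint shB (m : nat) : A := if m is m'.+1 then 1 + T m' * shB m' else 0.

Fixpoint shBs (m : nat) : A := if m is m'.+1 then 1 + shBs m' * T m' else 0.

(* [jm m] is [q ^+ m] times the Jucys-Murphy element of index [m]; this
   normalisation needs no negative power of [q]. *)
Fixpoint jm (m : nat) : A :=
  if m is m'.+1 then
    if m' is _.+1 then T m' * jm m' * T m' + q ^+ m' * T m' else 0
  else 0.

(* [shP n k] is [B*_{n,k} B_{n,k}] in the notation of the paper. *)
Fixpoint shP (m k : nat) : A :=
  if k is k'.+1 then shBs m * shP m.-1 k' * shB m else 1.

Lemma shB_S m : shB m.+1 = 1 + T m * shB m. Proof. by []. Qed.
Lemma shBs_S m : shBs m.+1 = 1 + shBs m * T m. Proof. by []. Qed.
Lemma jm_SS m : jm m.+2 = T m.+1 * jm m.+1 * T m.+1 + q ^+ m.+1 * T m.+1.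
Proof. by []. Qed.
Lemma shP0 m : shP m 0 = 1. Proof. by []. Qed.
Lemma shP_S m k : shP m k.+1 = shBs m * shP m.-1 k * shB m.
Proof. by []. Qed.

Lemma shP_gt m k : (m < k)%N -> shP m k = 0.
Proof.
elim: m k => [|m IHm] [|k] //= mk; first by rewrite !mul0r.
by rewrite IHm // mulr0 mul0r.
Qed.

End Shuffles.

(** In the opposite ring [shB] and [shBs] are exchanged, while [jm], [shP] and [qint] keep their
    values; an identity thus yields its mirror image. *)
Lemma shB_converse (A : nzRingType) (T : nat -> A) m :
  @shB A^c T m = shBs T m.
Proof. by elim: m => //= m ->. Qed.

Lemma shBs_converse (A : nzRingType) (T : nat -> A) m :
  @shBs A^c T m = shB T m.
Proof. by elim: m => //= m ->. Qed.

Lemma jm_converse (A : nzRingType) (q : A) (T : nat -> A) m :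
  (forall x : A, GRing.comm x q) -> @jm A^c q T m = jm q T m.
Proof.
move=> qC; elim: m => // -[|m] // IHm; rewrite jm_SS IHm revrX.
transitivity (T m.+1 * (jm q T m.+1 * T m.+1) + T m.+1 * q ^+ m.+1) => //.
by rewrite mulrA (commrX m.+1 (qC (T m.+1))).
Qed.

Lemma shP_converse (A : nzRingType) (T : nat -> A) m k :
  @shP A^c T m k = shP T m k.
Proof.
elim: k m => // k IHk m; rewrite !shP_S IHk shB_converse shBs_converse.
exact/(@mulrA A).
Qed.

Lemma qint_converse (A : nzRingType) (q : A) k : @qint A^c q k = qint q k.
Proof. by apply: eq_bigr => i _; rewrite revrX. Qed.

(** * Relations between shuffles and Jucys-Murphy elements *)

Section Relations.
Variables (A : nzRingType) (q : A) (N : nat) (T : nat -> A).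
Hypothesis HT : hecke_rel q N T.

Local Notation B := (shB T).
Local Notation Bs := (shBs T).
Local Notation P := (shP T).
Local Notation L := (jm q T).
Local Notation quad := (hecke_rel_quad HT).
Local Notation braid := (hecke_rel_braid HT).

Let qC x : x * q = q * x. Proof. exact: (hecke_rel_central HT). Qed.

Lemma comm_shB x m :
  (forall i, (0 < i < m)%N -> GRing.comm x (T i)) -> GRing.comm x (B m).
Proof.
elim: m => [|m IHm] xT; first exact: commr0.
apply/commrD; first exact: commr1.
(* The hypothesis says nothing about [T 0], but here it multiplies zero. *)
case: m => [|m] in IHm xT *; first by rewrite mulr0; apply: commr0.
by apply: commrM; [apply: xT; lia | apply: IHm => i im; apply: xT; lia].
Qed.

Lemma comm_shBs x m :
  (forall i, (0 < i < m)%N -> GRing.comm x (T i)) -> GRing.comm x (Bs m).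
Proof.
elim: m => [|m IHm] xT; first exact: commr0.
apply/commrD; first exact: commr1.
case: m => [|m] in IHm xT *; first by rewrite mul0r; apply: commr0.
by apply: commrM; [apply: IHm => i im; apply: xT; lia | apply: xT; lia].
Qed.

Lemma comm_shP x m k :
  (forall i, (0 < i < m)%N -> GRing.comm x (T i)) -> GRing.comm x (P m k).
Proof.
elim: k m => [|k IHk] m xT; first exact: commr1.
apply: commrM; last exact: comm_shB.
by apply: commrM; [exact: comm_shBs | apply: IHk => i im; apply: xT; lia].
Qed.

Lemma gen_comm_gen m j : (m < j < N)%N ->
  forall i, (0 < i < m)%N -> GRing.comm (T j) (T i).
Proof. by move=> mjN i im; apply/commr_sym/(hecke_rel_comm HT); lia. Qed.

Lemma comm_gen_jm m j : (m < j < N)%N -> GRing.comm (T j) (L m).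
Proof.
elim: m => [|m IHm] mjN; first exact: commr0.
case: m => [|m] in IHm mjN *; first exact: commr0.
have cT : GRing.comm (T j) (T m.+1).
  by apply/commr_sym/(hecke_rel_comm HT); lia.
have cL : GRing.comm (T j) (L m.+1) by apply: IHm; lia.
by apply: commrD; repeat apply: commrM; rewrite //; apply/commrX/qC.
Qed.

Lemma jm_comm_gen m i : (0 < i)%N -> (i.+1 < m)%N -> (m <= N)%N ->
  GRing.comm (L m) (T i).
Proof.
elim: m => [|m IHm] // i0 im mN; case: m => [|m] in IHm im mN *; first by lia.
have [im'|im'] := ltnP i m.
  have cT : GRing.comm (T i) (T m.+1) by apply: (hecke_rel_comm HT); lia.
  have cL : GRing.comm (T i) (L m.+1) by apply/commr_sym/IHm; lia.
  apply/commr_sym/commrD; repeat apply: commrM; rewrite //.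
  exact/commrX/qC.
(* In the remaining case the recursion for [jm] is unfolded twice, down to an [X] that commutes with
   [t]. *)
have {im'} -> : i = m by lia.
case: m => [|m] in IHm im mN *; first by lia.
have bs := @braid m.+1 isT mN; rewrite !jm_SS.
have qs : T m.+1 * T m.+1 = (q - 1) * T m.+1 + q by apply: quad; lia.
have qt : T m.+2 * T m.+2 = (q - 1) * T m.+2 + q by apply: quad; lia.
have cX : T m.+2 * L m.+1 = L m.+1 * T m.+2 by apply: comm_gen_jm; lia.
move: (T m.+1) (T m.+2) (L m.+1) bs qs qt cX => s t X bs qs qt cX.
have pC x : x * q ^+ m.+1 = q ^+ m.+1 * x by apply/commrX/qC.
rewrite [q ^+ m.+2]exprS; move: (q ^+ m.+1) pC => p pC.
have -> : t * (s * X * s + p * s) * t + q * p * t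
        = t * s * X * s * t + p * (s * t * s + q * t).
  rewrite mulrDr mulrDl !mulrA (pC t) -qC bs; ncring.
(* Braiding on the right, moving [t] across [X] and braiding on the left carries [s] through; for
   the other summand the quadratic relation gives a symmetric expression. *)
have e1 : (t * s * X * s * t) * s = s * (t * s * X * s * t).
  transitivity (t * s * X * (s * t * s)); first by ncring.
  rewrite bs; transitivity (t * s * (X * t) * s * t); first by ncring.
  rewrite -cX; transitivity ((t * s * t) * X * s * t); first by ncring.
  by rewrite -bs; ncring.
have e2 : (s * t * s + q * t) * s = s * (s * t * s + q * t).
  transitivity (s * t * (s * s) + q * t * s); first by ncring.
  transitivity ((s * s) * t * s + (s * q) * t); last by ncring.
  rewrite qs qC.
  transitivity (s * (t * q - t) * s + (s * t) * q + q * t * s); first by ncring.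
  transitivity ((q - 1) * s * t * s + q * t * s + q * s * t); last by ncring.
  rewrite !qC.
  transitivity ((s * q) * t * s - s * t * s + q * (s * t) + q * t * s).
    by ncring.
  by rewrite qC; ncring.
rewrite /GRing.comm mulrDl e1 -[p * _ * s]mulrA e2 [RHS]mulrDr; congr (_ + _).
by rewrite !mulrA (pC s).
Qed.

(** Induction: the top generator commutes with the inner shuffle, and a braid move then exposes the
    previous case. *)
Lemma gen_mul_shB m : (m < N)%N -> T m * (B m * B m.+1) = q * (B m * B m.+1).
Proof.
elim: m => [|m IHm] mN; first by rewrite mul0r !mulr0.
rewrite (shB_S T m.+1); case: m => [|m] in IHm mN *.
  rewrite shB_S mulr0 addr0 !mul1r mulr1 mulrDr mulr1 quad; last lia.
  by ncring.
have := IHm (ltnW mN); rewrite (shB_S T m.+1).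
have cb : T m.+2 * B m.+1 = B m.+1 * T m.+2 by apply/comm_shB/gen_comm_gen; lia.
have qt : T m.+2 * T m.+2 = (q - 1) * T m.+2 + q by apply: quad; lia.
have := @braid m.+1 isT mN.
move: (T m.+1) (T m.+2) (B m.+1) cb qt => s t b cb qt bs {}IHm.
set Y := 1 + s * b in IHm *.
transitivity (t * Y + (t * t + t * s * (b * t)) * Y).
  by rewrite /Y; ncring.
rewrite -cb; transitivity (t * Y + t * t * Y + (t * s * t) * b * Y).
  by ncring.
rewrite -bs qt; transitivity (q * t * Y + q * Y + s * t * (s * (b * Y))).
  by ncring.
rewrite IHm; transitivity (q * t * Y + q * Y + (s * t * q) * b * Y).
  by ncring.
rewrite qC; transitivity (q * (Y + t * Y + s * (t * b) * Y)); first by ncring.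
by rewrite cb /Y; ncring.
Qed.

(** Induction: expanding both factors puts the previous case between two copies of the new
    generator. Braiding handles its first term, the quadratic relation its [q]-integer, and the
    recursion for [jm] its last term. *)
Lemma shB_shBs m : (m < N)%N ->
  B m.+1 * Bs m.+1 = Bs m * T m * B m + qint q m.+1 + L m.+1.
Proof.
elim: m => [|m IHm] mN; first by rewrite /= qintS qint0; ncring.
rewrite (shB_S T m.+1) (shBs_S T m.+1) jm_SS.
have qt : T m.+1 * T m.+1 = (q - 1) * T m.+1 + q by apply: quad; lia.
have braided : T m.+1 * (Bs m * T m * B m) * T m.+1
             = Bs m * T m * T m.+1 * T m * B m.
  case: m => [|m] in {IHm qt} mN *; first by rewrite /= !(mulr0, mul0r).
  have cB : T m.+2 * B m.+1 = B m.+1 * T m.+2.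
    by apply/comm_shB/gen_comm_gen; lia.
  have cBs : T m.+2 * Bs m.+1 = Bs m.+1 * T m.+2.
    by apply/comm_shBs/gen_comm_gen; lia.
  have bs := @braid m.+1 isT mN.
  transitivity ((T m.+2 * Bs m.+1) * T m.+1 * (B m.+1 * T m.+2)).
    by ncring.
  rewrite cBs -cB; transitivity
    (Bs m.+1 * (T m.+2 * T m.+1 * T m.+2) * B m.+1); first by ncring.
  by rewrite -bs; ncring.
have kC : T m.+1 * qint q m.+1 = qint q m.+1 * T m.+1.
  exact/qint_comm/qC.
have {}IHm := IHm (ltnW mN).
transitivity (1 + T m.+1 * B m.+1 + Bs m.+1 * T m.+1
              + T m.+1 * (B m.+1 * Bs m.+1) * T m.+1); first by ncring.
rewrite IHm; transitivity (1 + T m.+1 * B m.+1 + Bs m.+1 * T m.+1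
  + (T m.+1 * (Bs m * T m * B m) * T m.+1 + T m.+1 * qint q m.+1 * T m.+1
     + T m.+1 * L m.+1 * T m.+1)); first by ncring.
rewrite braided kC -[qint q m.+1 * _ * _]mulrA qt (shB_S T m) (shBs_S T m).
have qk : qint q m.+1 * q = q * qint q m.+1 by apply: qC.
have e1 : qint q m.+2 = 1 + qint q m.+1 * q by rewrite qintS qk.
have e2 : q ^+ m.+1 = 1 + qint q m.+1 * q - qint q m.+1.
  by rewrite -e1 qintSr addrAC subrr add0r.
by rewrite e1 e2; ncring.
Qed.

#[local] Arguments shB : simpl never.
#[local] Arguments shBs : simpl never.
#[local] Arguments jm : simpl never.
#[local] Arguments shP : simpl never.

(* The relation is multiplied by [q ^+ k], and [m - k] is called [d], to keep clear
   of negative powers and of truncated subtraction. *)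
Lemma shB_shP d k : (d + k < N)%N ->
  q ^+ k * (B (d + k).+1 * P (d + k).+1 k.+1) =
  (q ^+ k.*2.+1 * P (d + k) k.+1
   + qint q k.+1 * (q ^+ k * qint q d.+1 + L (d + k).+1) * P (d + k) k)
  * B (d + k).+1.
Proof.
elim: k => [|k IHk] dkN.
  rewrite addn0 in dkN *.
  rewrite !shP_S !shP0 [qint q 1]qintS qint0 !expr0 expr1 mul1r /=.
  transitivity (B d.+1 * Bs d.+1 * B d.+1); first by ncring.
  rewrite shB_shBs //.
  transitivity (Bs d * (T d * (B d * B d.+1))
                + (qint q d.+1 + L d.+1) * B d.+1); first by ncring.
  rewrite gen_mul_shB // [Bs d * _]mulrA (qC (Bs d)); ncring.
rewrite addnS in dkN *; have {IHk} := IHk (ltnW dkN).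
set M := (d + k)%N in dkN *.
rewrite (shP_S T M.+1 k.+1) (shP_S T M.+2 k.+1) (shP_S T M.+1 k) /=.
(* [F1] splits the central product [B M.+2 * Bs M.+2] into three terms; the one containing [T M.+1]
   exposes [B M.+1 * P M.+1 k.+1], to which induction applies. *)
have F1 := shB_shBs dkN; have F2 := gen_mul_shB dkN.
have c0 : T M.+1 * P M k = P M k * T M.+1.
  by apply/comm_shP/gen_comm_gen; lia.
have c1 : T M.+1 * P M k.+1 = P M k.+1 * T M.+1.
  by apply/comm_shP/gen_comm_gen; lia.
have cL : L M.+2 * Bs M.+1 = Bs M.+1 * L M.+2.
  by apply/comm_shBs => i iM; apply: jm_comm_gen; lia.
have FL := jm_SS q T M.
have XC p x : x * q ^+ p = q ^+ p * x by apply/commrX/qC.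
have nC p x : x * qint q p = qint q p * x by apply/qint_comm/qC.
(* [T M.+1] passes through the factors [P M _], so by [F2] it acts on [Z0] and [Z1] as [q]. *)
set Z0 := P M k * (B M.+1 * B M.+2).
set Z1 := P M k.+1 * (B M.+1 * B M.+2).
have H0 : T M.+1 * Z0 = q * Z0 by rewrite mulrA c0 -mulrA F2 mulrA qC -mulrA.
have H1 : T M.+1 * Z1 = q * Z1 by rewrite mulrA c1 -mulrA F2 mulrA qC -mulrA.
(* The extra [q] supplies, through [H0], the second [T M.+1] in the recursion for [jm]. *)
have H2 : q * (T M.+1 * (L M.+1 * Z0)) = L M.+2 * Z0 - q ^+ M.+2 * Z0.
  rewrite FL [q ^+ M.+2]exprSr.
  transitivity (T M.+1 * L M.+1 * (q * Z0)); first by rewrite !mulrA qC !mulrA.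
  by rewrite -H0 -[q ^+ _ * q * _]mulrA -H0; ncring.
move: (B M.+2) (Bs M.+2) F1 F2 @Z0 @Z1 H0 H1 H2.
move: (B M.+1) (Bs M.+1) (L M.+2) (L M.+1) (P M k) (P M k.+1) cL {c0 c1 FL}.
move: (T M.+1).
move=> t b bs L2 L1 P0 P1 cL b2 bs2 F1 F2 Z0 Z1 H0 H1 H2 IH.
set a := q ^+ k in XC IH *; set c := qint q k.+1 in nC IH *.
set e := qint q d.+1 in nC IH *; set u := q ^+ k.*2.+1 in IH *.
have aC x : x * a = a * x by apply: XC.
have cC x : x * c = c * x by apply: nC.
have eC x : x * e = e * x by apply: nC.
have uC x : x * u = u * x by apply: XC.
have {}IH : a * (b * (bs * P0 * b)) * b2 = u * Z1 + c * a * e * Z0 + c * L1 * Z0.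
  by rewrite IH /Z0 /Z1; ncring.
have vC x : x * (c * a * e) = c * a * e * x.
  by apply: commrM; [apply: commrM; [exact: cC | exact: aC] | exact: eC].
transitivity (q * (a * (b2 * bs2) * (bs * P0 * b) * b2)).
  by rewrite exprS -/a; ncring.
rewrite F1; set v := c * a * e in vC IH *.
transitivity (q * ((a * (bs * t)) * (b * (bs * P0 * b)) * b2)
              + q * a * qint q M.+2 * bs * Z0 + q * a * (L2 * bs) * Z0).
  by rewrite /Z0; ncring.
rewrite -aC cL.
transitivity (q * ((bs * t) * (a * (b * (bs * P0 * b)) * b2))
              + q * a * qint q M.+2 * bs * Z0 + q * a * bs * L2 * Z0).
  by ncring.
rewrite IH.
transitivity (q * bs * ((t * u) * Z1 + (t * v) * Z0 + (t * c) * (L1 * Z0))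
              + q * a * qint q M.+2 * bs * Z0 + q * a * bs * L2 * Z0).
  by ncring.
rewrite uC vC cC -(qC bs).
transitivity (bs * (q * u * (t * Z1) + q * v * (t * Z0)
                    + (q * c) * (t * (L1 * Z0)))
              + q * a * qint q M.+2 * bs * Z0 + q * a * bs * L2 * Z0).
  by ncring.
rewrite H0 H1 -(qC c) -[c * q * _]mulrA H2.
transitivity ((bs * (q * u * q)) * Z1 + (bs * (q * v * q - c * q ^+ M.+2)) * Z0
              + (bs * (c + q * a)) * L2 * Z0 + q * a * qint q M.+2 * bs * Z0
              + (q * a * bs - bs * (q * a)) * L2 * Z0).
  by ncring.
have qaC x : x * (q * a) = q * a * x.
  by apply: commrM; [exact: qC | exact: aC].
rewrite (qaC bs) subrr !mul0r addr0.
have uqC x : x * (q * u * q) = q * u * q * x.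
  by apply: commrM; [apply: commrM; [exact: qC | exact: uC] | exact: qC].
have vqC x : x * (q * v * q - c * q ^+ M.+2) = (q * v * q - c * q ^+ M.+2) * x.
  apply: commrB; apply: commrM; [|exact: qC|exact: cC|exact: XC].
  by apply: commrM; [exact: qC | exact: vC].
have cqaC x : x * (c + q * a) = (c + q * a) * x.
  by apply: commrD; [exact: cC | exact: qaC].
(* The coefficient of [Z0]. It follows from $[M+2]_q = [k+1]_q + q^{k+1}[d+1]_q$ and $q^{d+1} = 1 +
   q[d+1]_q - [d+1]_q$. *)
have scalars : q * v * q - c * q ^+ M.+2 + q * a * qint q M.+2
             = (c + q * a) * (q * a * e).
  have eM : q ^+ M.+2 = q * (a * (1 + q * e - e)).
    rewrite exprS /M addnC -addnS exprD -/a; congr (q * (a * _)).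
    by rewrite -qintS qintSr addrAC subrr add0r.
  have -> : qint q M.+2 = c + q * a * e.
    by rewrite /M addnC -addnS -addSn qintD -/c -/e exprS.
  rewrite eM /v; transitivity (q * (c * a) * (e * q) - c * (q * a) * (1 - e)
    - c * (q * a) * q * e + q * a * c + q * a * (q * a) * e); first by ncring.
  transitivity (c * (q * a) * e + q * a * (q * a) * e); last by ncring.
  by rewrite (qC e) (qaC c) -(cC a); ncring.
have -> : q ^+ k.+1.*2.+1 = q * u * q by rewrite -exprS -exprSr doubleS.
have -> : qint q k.+2 = c + q * a by rewrite qintSr exprS.
rewrite uqC vqC cqaC exprS -/a.
transitivity (q * u * q * bs * Z1 +
  (q * v * q - c * q ^+ M.+2 + q * a * qint q M.+2) * bs * Z0
  + (c + q * a) * (bs * L2) * Z0); first by ncring.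
by rewrite scalars -cL /Z0 /Z1; ncring.
Qed.

End Relations.

(** This is [shB_shP] in the opposite ring, which also explains the reversed order of the scalar
    factors. *)
Lemma shP_shBs (A : nzRingType) (q : A) N (T : nat -> A) d k :
  hecke_rel q N T -> (d + k < N)%N ->
  shP T (d + k).+1 k.+1 * shBs T (d + k).+1 * q ^+ k =
  shBs T (d + k).+1 *
  (shP T (d + k) k.+1 * q ^+ k.*2.+1 + shP T (d + k) k *
   ((qint q d.+1 * q ^+ k + jm q T (d + k).+1) * qint q k.+1)).
Proof.
move=> HT dkN.
have := shB_shP (hecke_rel_converse HT) dkN.
rewrite !shP_converse !shB_converse !qint_converse !jm_converse ?revrX //.
exact: hecke_rel_central HT.
Qed.

Lemma shP_commute (A : nzRingType) (q : A) N (T : nat -> A) m i j :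
  hecke_rel q N T -> GRing.lreg q -> (m <= N)%N ->
  GRing.comm (shP T m i) (shP T m j).
Proof.
move=> HT q_reg; elim: m i j => [|m IHm] [|i] [|j] mN;
  try exact: commr1; try exact/commr_sym/commr1.
  by rewrite !shP_gt.
have [mj|jm'] := ltnP m j; first by rewrite (@shP_gt _ _ m.+1 j.+1) //; apply: commr0.
have qC := hecke_rel_central HT.
have [d dE] : {d | m = d + j}%N by exists (m - j)%N; rewrite subnK.
have := @shB_shP _ _ _ _ HT d j; have := @shP_shBs _ _ _ _ d j HT.
rewrite -dE => /(_ mN) Eright /(_ mN) Eleft.
rewrite /GRing.comm; apply: (lregX (n := j) q_reg).
have cP k l : GRing.comm (shP T m k) (shP T m l) by apply: IHm; apply: ltnW.
have cL k : GRing.comm (jm q T m.+1) (shP T m k).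
  by apply: comm_shP => l lm; apply: (jm_comm_gen HT); lia.
pose W := q ^+ j.*2.+1 * shP T m j.+1
  + qint q j.+1 * (q ^+ j * qint q d.+1 + jm q T m.+1) * shP T m j.
have cq x n : GRing.comm x (q ^+ n) by apply/commrX/qC.
have cW k : shP T m k * W = W * shP T m k.
  apply: commrD; first exact: commrM.
  apply: commrM => //; apply: commrM; first exact/qint_comm/qC.
  apply: commrD; last exact/commr_sym/cL.
  by apply: commrM => //; apply/qint_comm/qC.
(* The left and right identities involve the same [W], once the central factors are put in the same
   order. *)
have WE : W = shP T m j.+1 * q ^+ j.*2.+1 + shP T m j *
   ((qint q d.+1 * q ^+ j + jm q T m.+1) * qint q j.+1).
  rewrite cq [qint q d.+1 * _]cq /W; congr (_ + _).
  set X := q ^+ j * _ + _; rewrite (@qint_comm _ q X j.+1 (qC X)) mulrA.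
  rewrite (@qint_comm _ q _ j.+1 (qC (shP T m j))) -!mulrA; congr (_ * _).
  rewrite -/(GRing.comm X _) /X; apply/commr_sym/commrD; last exact/commr_sym/cL.
  by apply: commrM => //; apply/qint_comm/qC.
(* Both products, times [q ^+ j], equal $B^*_{m+1} P_{m,i} W B_{m+1}$: one by [Eleft], the other by
   [Eright] after [W] has moved across $P_{m,i}$. *)
transitivity (shBs T m.+1 * (shP T m i * W) * shB T m.+1).
  transitivity (shBs T m.+1 * shP T m i
                * (q ^+ j * (shB T m.+1 * shP T m.+1 j.+1))).
    by rewrite (shP_S T m.+1 i) !mulrA (cq (_ * shP T m i)) !mulrA.
  by rewrite Eleft -/W !mulrA.
transitivity (shP T m.+1 j.+1 * shBs T m.+1 * q ^+ j
              * (shP T m i * shB T m.+1)).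
  by rewrite Eright -WE cW !mulrA.
by rewrite (shP_S T m.+1 i) cq !mulrA.
Qed.

(** * Torsion-freeness of the Hecke algebra *)

Local Open Scope quotient_scope.

Section Tower.
Variables (R : comNzRingType) (q : R).

Lemma comm_in_alg (A : algType R) (x : A) (a : R) : GRing.comm x a%:A.
Proof. by rewrite /GRing.comm mulr_algl mulr_algr. Qed.

Lemma hecke_hT_rel n : hecke_rel (q%:A : hecke q n) n (hT q n).
Proof.
split=> [x|i iN|i j|i]; last 2 first.
- exact: hT_comm.
- exact: hT_braid.
- exact: comm_in_alg.
- by rewrite hT_quad // mulrBl mulr_algl mul1r scalerBl scale1r.
Qed.

Variable N : nat.
Local Notation H := (hecke q N).
Local Notation H' := (hecke q N.+1).
Local Notation T := (hT q N).
Local Notation T' := (hT q N.+1).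

Definition hincl (x : H) : H' :=
  heval (in_alg H') (fun i => T' (val i)) (repr x).

Lemma hincl_pi (x : hterm R N) :
  hincl (\pi_H x) = heval (in_alg H') (fun i => T' (val i)) x.
Proof.
have [_ TQ TC TB] := hecke_hT_rel N.+1.
apply: (@heval_hequiv _ q); last exact: hrepr_pi.
- by move=> a y; apply/esym/comm_in_alg.
- case=> i /= iN; rewrite TQ; last lia.
  by rewrite /= scalerBl scale1r.
- by case=> i /= iN [j /= jN] ij; apply: TC; lia.
- by case=> i /= iN [j /= jN] ->; apply: TB; lia.
Qed.

Lemma hinclD x y : hincl (x + y) = hincl x + hincl y.
Proof.
by elim/hecke_ind: x => x; elim/hecke_ind: y => y;
  rewrite -[_ + _]pi_hadd !hincl_pi.
Qed.

Lemma hinclM x y : hincl (x * y) = hincl x * hincl y.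
Proof.
by elim/hecke_ind: x => x; elim/hecke_ind: y => y;
  rewrite -[_ * _]pi_hmul !hincl_pi.
Qed.

Lemma hincl_alg a : hincl a%:A = a%:A.
Proof. by rewrite -hscalE hincl_pi. Qed.

Lemma hinclT i : (0 < i < N)%N -> hincl (T i) = T' i.
Proof.
by move=> iN; rewrite -[i]/(val (exist _ i iN : hgen N)) hT_gen hincl_pi.
Qed.

Local Notation Q := (q%:A : H).

(* The right action of [T' j] on the free left [H]-module with basis
   [T' N * ... * T' c.+1], [0 <= c <= N], of which [m c] is the coordinate of
   index [c]; the coordinates of index [c > N] play no role. *)
Definition gact (j : nat) (m : nat -> H) (c : nat) : H :=
  if (N < c)%N then Q * m c
  else if (c.+1 < j)%N then m c * T j.-1
  else if c.+1 == j then m j + (Q - 1) * m c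
  else if c == j then Q * m j.-1
  else m c * T j.

(** Out of range each generator acts as the scalar [q], which is itself a representation, so the
    relations hold at every index. *)
Lemma gact_out j m c : (N < c)%N -> gact j m c = Q * m c.
Proof. by rewrite /gact => ->. Qed.

Ltac unfold_gact := rewrite /gact; repeat (case: ifP => ?; try lia); done.

(** The regimes of $T_N \cdots T_{c+1} T_j$: for $c+1<j$ braiding turns $T_j$ into $T_{j-1}$ on the
    left; for $c+1=j$ the quadratic relation applies; for $c=j$ the product grows by one factor; for
    $c>j$ the generator commutes with it. *)
Lemma gact_lt j m c : (c.+1 < j <= N)%N -> gact j m c = m c * T j.-1.
Proof. move=> ?; unfold_gact. Qed.

Lemma gact_pred j m : (j < N)%N -> gact j.+1 m j = m j.+1 + (Q - 1) * m j.
Proof. move=> ?; unfold_gact. Qed.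

Lemma gact_eq j m : (j < N)%N -> gact j.+1 m j.+1 = Q * m j.
Proof. move=> ?; unfold_gact. Qed.

Lemma gact_gt j m c : (j < c <= N)%N -> gact j m c = m c * T j.
Proof. move=> ?; unfold_gact. Qed.

Variant gact_region (j c : nat) : Prop :=
| GactOut of (N < c)%N
| GactLt of (c.+1 < j <= N)%N
| GactPred of c.+1 = j
| GactEq of c = j
| GactGt of (j < c <= N)%N.

Lemma gact_regionP j c : (j <= N)%N -> gact_region j c.
Proof.
move=> jN; have [cN|cN] := ltnP N c; first exact: GactOut.
have [cj|cj] := ltnP c.+1 j; first by apply: GactLt; rewrite cj.
have [jc|jc] := ltnP j c; first by apply: GactGt; rewrite jc.
have [->|cj'] := eqVneq c j; first exact: GactEq.
by apply: GactPred; lia.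
Qed.

Let QC (x : H) : x * Q = Q * x. Proof. exact: comm_in_alg. Qed.
Let relH := hecke_hT_rel N.

Lemma gact_quad j m : (0 < j <= N)%N ->
  gact j (gact j m) = fun c => (Q - 1) * gact j m c + Q * m c.
Proof.
case: j => // j jN; apply: funext => c.
case: (@gact_regionP j.+1 c jN) => [oN|lt|[->]|->|gt].
- by rewrite !gact_out //; ncring.
- rewrite !gact_lt // -mulrA (hecke_rel_quad relH) /=; last lia.
  transitivity ((m c * Q) * T j - m c * T j + m c * Q); first by ncring.
  by rewrite QC; ncring.
- by rewrite gact_pred // gact_eq // gact_pred //; ncring.
- by rewrite !gact_eq // gact_pred //; ncring.
- rewrite !gact_gt // -mulrA (hecke_rel_quad relH); last lia.
  transitivity ((m c * Q) * T j.+1 - m c * T j.+1 + m c * Q); first by ncring.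
  by rewrite QC; ncring.
Qed.

Lemma gact_comm i j m : (0 < i)%N -> (i.+1 < j <= N)%N ->
  gact i (gact j m) = gact j (gact i m).
Proof.
case: i j => // i [|j] // _ ijN; apply: funext => c.
have TC k l : (0 < k)%N -> (k.+1 < l)%N -> (l < N)%N -> T k * T l = T l * T k.
  exact: (hecke_rel_comm relH).
case: (@gact_regionP i.+1 c); first lia.
- by move=> cN; rewrite !gact_out.
- move=> ci; rewrite !gact_lt /=; try lia.
  by rewrite -!mulrA -(TC i j) //; lia.
- move=> [->].
  have lJ f : gact j.+1 f i = f i * T j by apply: gact_lt; lia.
  have lJ' f : gact j.+1 f i.+1 = f i.+1 * T j by apply: gact_lt; lia.
  have pI f : gact i.+1 f i = f i.+1 + (Q - 1) * f i by apply: gact_pred; lia.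
  by rewrite !(lJ, pI, lJ') [RHS]mulrDl mulrA.
- move=> ->.
  have lJ f : gact j.+1 f i = f i * T j by apply: gact_lt; lia.
  have lJ' f : gact j.+1 f i.+1 = f i.+1 * T j by apply: gact_lt; lia.
  have eI f : gact i.+1 f i.+1 = Q * f i by apply: gact_eq; lia.
  by rewrite !(lJ', eI, lJ) mulrA.
- move=> ic; have gI f : gact i.+1 f c = f c * T i.+1 by apply: gact_gt; lia.
  case: (@gact_regionP j.+1 c); first lia.
  + by lia.
  + move=> cj; have lJ f : gact j.+1 f c = f c * T j by apply: gact_lt; lia.
    by rewrite !(gI, lJ) -!mulrA (TC i.+1 j) //; lia.
  + move=> [cj]; rewrite cj in ic gI *.
    have gI' f : gact i.+1 f j.+1 = f j.+1 * T i.+1 by apply: gact_gt; lia.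
    have pJ f : gact j.+1 f j = f j.+1 + (Q - 1) * f j by apply: gact_pred; lia.
    by rewrite !(gI, gI', pJ) [LHS]mulrDl mulrA.
  + move=> cj; rewrite cj in ic gI *.
    have gI' f : gact i.+1 f j = f j * T i.+1 by apply: gact_gt; lia.
    have eJ f : gact j.+1 f j.+1 = Q * f j by apply: gact_eq; lia.
    by rewrite !(gI, gI', eJ) mulrA.
  + move=> jc; rewrite !gact_gt; try lia.
    by rewrite -!mulrA -(TC i.+1 j.+1) //; lia.
Qed.

Lemma gact_braid j m : (0 < j < N)%N ->
  gact j (gact j.+1 (gact j m)) = gact j.+1 (gact j (gact j.+1 m)).
Proof.
case: j => // j jN; apply: funext => c.
have TB k : (0 < k)%N -> (k.+1 < N)%N ->
  T k * T k.+1 * T k = T k.+1 * T k * T k.+1 by exact: (hecke_rel_braid relH).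
have TQ : T j.+1 * T j.+1 = (Q - 1) * T j.+1 + Q.
  exact: (hecke_rel_quad relH).
have pJ f : gact j.+1 f j = f j.+1 + (Q - 1) * f j by apply: gact_pred; lia.
have eJ f : gact j.+1 f j.+1 = Q * f j by apply: gact_eq; lia.
have gJ f : gact j.+1 f j.+2 = f j.+2 * T j.+1 by apply: gact_gt; lia.
have pK f : gact j.+2 f j.+1 = f j.+2 + (Q - 1) * f j.+1.
  by apply: gact_pred; lia.
have eK f : gact j.+2 f j.+2 = Q * f j.+1 by apply: gact_eq; lia.
have lK f : gact j.+2 f j = f j * T j.+1 by apply: gact_lt; lia.
case: (@gact_regionP j.+1 c); first lia.
- by move=> cN; rewrite !gact_out.
- move=> cj; rewrite !gact_lt /=; try lia.
  by rewrite -!(mulrA (m c)) TB //; lia.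
- move=> [->]; rewrite !(pJ, eJ, gJ, pK, eK, lK).
  (* At this index the two sides agree only by the quadratic relation for [T j.+1] in [H]. *)
  have mTT : (Q - 1) * m j * T j.+1 + Q * m j = m j * (T j.+1 * T j.+1).
    transitivity ((m j * Q) * T j.+1 - m j * T j.+1 + m j * Q).
      by rewrite QC; ncring.
    by rewrite TQ; ncring.
  transitivity (m j.+2 * T j.+1 + (Q - 1) * m j.+1 * T j.+1
                + (Q - 1) * ((Q - 1) * m j * T j.+1 + Q * m j)).
    by ncring.
  by rewrite mTT; ncring.
- by move=> ->; rewrite !(pJ, eJ, gJ, pK, eK, lK); ncring.
- move=> jc; case: (@gact_regionP j.+2 c); try lia.
  + by move=> ->; rewrite !(pJ, eJ, gJ, pK, eK, lK); ncring.
  + move=> jc'; rewrite !gact_gt; try lia.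
    by rewrite -!(mulrA (m c)) TB //; lia.
Qed.

(** Defined on expressions, and compatible with the congruence by [hact_hequiv]. A product applies
    its left factor first because the action is on the right. *)
Fixpoint hact (x : hterm R N.+1) (m : nat -> H) : nat -> H :=
  match x with
  | HScal a => fun c => a%:A * m c
  | HGen g => gact (val g) m
  | HAdd x y => fun c => hact x m c + hact y m c
  | HMul x y => hact y (hact x m)
  end.

Lemma gactD j m m' c :
  gact j (fun c => m c + m' c) c = gact j m c + gact j m' c.
Proof. by rewrite /gact; do ?case: ifP => _; ncring. Qed.

Lemma gactZ j a m c :
  gact j (fun c => a%:A * m c) c = a%:A * gact j m c.
Proof.
have aQ : Q * a%:A = a%:A * Q by rewrite QC.
have aQ1 : (Q - 1) * a%:A = a%:A * (Q - 1) by rewrite comm_in_alg.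
rewrite /gact /=; move: (a%:A : H) (Q) aQ aQ1 => x y xy xy1.
by do ?case: ifP => _; rewrite ?mulrDr ?mulrA ?xy1 ?xy.
Qed.

Lemma hactD x m m' c :
  hact x (fun c => m c + m' c) c = hact x m c + hact x m' c.
Proof.
elim: x m m' c => [a|g|x IHx y IHy|x IHx y IHy] m m' c /=.
- exact: mulrDr.
- exact: gactD.
- by rewrite IHx IHy addrACA.
- by rewrite -IHy; congr (hact y _ c); apply: funext => d; rewrite IHx.
Qed.

Lemma hactZ x a m c :
  hact x (fun c => a%:A * m c) c = a%:A * hact x m c.
Proof.
elim: x m c => [b|g|x IHx y IHy|x IHx y IHy] m c /=.
- by rewrite !mulr_algl !scalerA mulrC.
- exact: gactZ.
- by rewrite IHx IHy mulrDr.
- by rewrite -IHy; congr (hact y _ c); apply: funext => d; rewrite IHx.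
Qed.

Lemma hact_hequiv x y : hequiv q x y -> hact x = hact y.
Proof.
elim=> {x y} //=.
- by move=> x y z _ -> _ ->.
- by move=> x x' y y' _ -> _ ->.
- by move=> x x' y y' _ -> _ ->.
- by move=> x y z; apply/funext => m; apply/funext => c; rewrite addrA.
- by move=> x y; apply/funext => m; apply/funext => c; rewrite addrC.
- by move=> x; apply/funext => m; apply/funext => c; rewrite scale0r mul0r add0r.
- move=> x; apply/funext => m; congr (hact x _).
  by apply/funext => c; rewrite scale1r mul1r.
- move=> x; apply/funext => m; apply/funext => c.
  by rewrite hactZ scale0r !mul0r.
- move=> x y z; apply/funext => m; apply/funext => c; exact: hactD.
- move=> a b; apply/funext => m; apply/funext => c.
  by rewrite scalerDl mulrDl.
- move=> a b; apply/funext => m; apply/funext => c.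
  by rewrite !mulr_algl scalerA mulrC.
- by move=> a x; apply/funext => m; apply/funext => c; exact: hactZ.
- case=> j /= jN; apply/funext => m; apply/funext => c.
  by rewrite gact_quad // gactZ scalerBl scale1r.
- move=> [i iN] [j jN] /= ij; apply/funext => m.
  by apply/esym/gact_comm; lia.
- move=> [i iN] [j jN] /= ij; subst j; apply/funext => m.
  by apply: gact_braid; lia.
Qed.

(** * Descending products and recovery of an element from its coordinates *)

Definition desc (a b : nat) : H' := \prod_(j <- rev (index_iota a b)) T' j.

Lemma desc_id a : desc a a = 1.
Proof. by rewrite /desc /index_iota subnn big_nil. Qed.

Lemma desc_recl a b : (a < b)%N -> desc a b = desc a.+1 b * T' a.
Proof.
move=> ab; rewrite /desc /index_iota -(subnSK ab) /= rev_cons.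
by rewrite -cats1 big_cat big_seq1.
Qed.

Lemma desc_recr a b : (a <= b)%N -> desc a b.+1 = T' b * desc a b.
Proof.
move=> ab; rewrite /desc /index_iota subSn // -[(b - a).+1]addn1 iotaD rev_cat.
by rewrite big_cat /= big_seq1 subnKC.
Qed.

Let relH' := hecke_hT_rel N.+1.

Lemma desc_cat a m b : (a <= m <= b)%N -> desc a b = desc m b * desc a m.
Proof.
move=> amb; rewrite /desc -big_cat -rev_cat /index_iota.
by rewrite (_ : b - a = (m - a) + (b - m))%N ?iotaD ?subnKC //; lia.
Qed.

Lemma gen_desc_comm k a b : (0 < k < N.+1)%N -> (0 < a)%N -> (b <= N.+1)%N ->
  (b <= k.-1)%N || (k.+1 < a)%N -> GRing.comm (T' k) (desc a b).
Proof.
move=> kN a0 bN kab; rewrite /desc big_seq.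
elim/big_rec: _ => [|l x lab xT]; first exact: commr1.
apply: commrM => //; move: lab; rewrite mem_rev mem_index_iota => lab.
by have [lk|kl] := ltnP l k; [apply: commr_sym|];
  apply: (hecke_rel_comm relH'); lia.
Qed.

(** Split around [T' j * T' j.-1]: the incoming [T' j] commutes with the lower part, a braid move
    turns it into [T' j.-1], and this commutes with the upper part. *)
Lemma desc_gen a b j : (0 < a < j)%N -> (j < b <= N.+1)%N ->
  desc a b * T' j = T' j.-1 * desc a b.
Proof.
case: j => [|j] aj jb /=; first lia.
rewrite (@desc_cat a j.+2 b); last lia.
rewrite desc_recr; last lia.
rewrite desc_recr; last lia.
have c1 : T' j.+1 * desc a j = desc a j * T' j.+1.
  by apply: gen_desc_comm; lia.
have c2 : T' j * desc j.+2 b = desc j.+2 b * T' j.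
  by apply: gen_desc_comm; lia.
have bs : T' j * T' j.+1 * T' j = T' j.+1 * T' j * T' j.+1.
  by apply: (hecke_rel_braid relH'); lia.
transitivity (desc j.+2 b * T' j.+1 * T' j * (desc a j * T' j.+1)).
  by ncring.
rewrite -c1; transitivity (desc j.+2 b * (T' j.+1 * T' j * T' j.+1) * desc a j).
  by ncring.
rewrite -bs; transitivity (desc j.+2 b * T' j * T' j.+1 * T' j * desc a j).
  by ncring.
by rewrite -c2; ncring.
Qed.

(* The inverse of [x |-> hact x hact1], where [x] ranges over [H']. *)
Definition tower_sum (m : nat -> H) : H' :=
  \sum_(0 <= c < N.+1) hincl (m c) * desc c.+1 N.+1.

Lemma hinclZ a x : hincl (a%:A * x) = a%:A * hincl x.
Proof. by rewrite hinclM hincl_alg. Qed.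

Lemma tower_sum_gact j m : (0 < j <= N)%N -> tower_sum (gact j m) = tower_sum m * T' j.
Proof.
case: j => // j jN; rewrite /tower_sum mulr_suml.
(* Only the coordinates [j] and [j.+1] are mixed by [T' j.+1], so they are isolated. *)
have split4 (F : nat -> H') : \sum_(0 <= c < N.+1) F c =
    \sum_(0 <= c < j) F c + (F j + F j.+1) + \sum_(j.+2 <= c < N.+1) F c.
  rewrite (big_cat_nat _ (n := j)) //=; last lia.
  rewrite (big_ltn (m := j)); last lia.
  by rewrite (big_ltn (m := j.+1)); [rewrite !addrA | lia].
rewrite !split4; congr (_ + _ + _).
- apply: eq_big_nat => c cj; rewrite gact_lt; last lia.
  by rewrite hinclM hinclT -?mulrA ?desc_gen //=; lia.
- rewrite gact_pred // gact_eq // hinclD hinclZ.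
  have -> : (Q - 1) * m j = (q - 1)%:A * m j by rewrite scalerBl scale1r.
  rewrite hinclZ scalerBl scale1r (@desc_recl j.+1); last lia.
  have TQ : T' j.+1 * T' j.+1 = (q%:A - 1) * T' j.+1 + q%:A.
    by apply: (hecke_rel_quad relH'); lia.
  have qC (x : H') : x * q%:A = q%:A * x by exact: comm_in_alg.
  set y := hincl (m j); set x := hincl (m j.+1); set D := desc _ _.
  transitivity (y * D * (T' j.+1 * T' j.+1) + x * D * T' j.+1); last by ncring.
  rewrite TQ; transitivity ((y * D * q%:A) * T' j.+1 - y * D * T' j.+1
    + y * D * q%:A + x * D * T' j.+1); last by ncring.
  by rewrite qC; ncring.
- apply: eq_big_nat => c cj; rewrite gact_gt; last lia.
  rewrite hinclM hinclT; last lia.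
  by rewrite -!mulrA; congr (_ * _); apply: gen_desc_comm; lia.
Qed.

Lemma tower_sum_hact x m : tower_sum (hact x m) = tower_sum m * \pi_H' x.
Proof.
elim: x m => [a|[j jN]|x IHx y IHy|x IHx y IHy] m /=.
- rewrite -[\pi_H' _]/(hscal q N.+1 a) hscalE comm_in_alg mulr_sumr.
  apply: eq_bigr => c _.
  by rewrite hinclZ mulrA.
- rewrite tower_sum_gact; last lia.
  by rewrite -[j in LHS]/(val (exist _ j jN : hgen N.+1)) hT_gen.
- rewrite [\pi_H' _]pi_hadd mulrDr -IHx -IHy -big_split.
  by apply: eq_bigr => c _; rewrite hinclD mulrDl.
- by rewrite [\pi_H' _]pi_hmul IHy IHx -mulrA.
Qed.

(** The coordinates of [1]: the basis element of index [N] is the empty product. *)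
Definition hact1 (c : nat) : H := if c == N then 1 else 0.

Lemma tower_sum_hact1 : tower_sum hact1 = 1.
Proof.
rewrite /tower_sum big_nat_recr //= desc_id /hact1 eqxx mulr1.
have -> : hincl 1 = 1 by rewrite -[1]scale1r hincl_alg scale1r.
rewrite big_nat big1 ?add0r // => c cN.
have -> : hincl (if c == N then 1 else 0) = 0; last exact: mul0r.
by rewrite ifN -?[0](scale0r 1) ?hincl_alg ?scale0r //; lia.
Qed.

(** By [tower_sum_hact] an element is recovered from its coordinates [hact x hact1], and scaling by
    [a] scales these, which lie in [H]. *)
Lemma torsion_free_step a :
  (forall x : H, a *: x = 0 -> x = 0) -> forall x : H', a *: x = 0 -> x = 0.
Proof.
move=> tfH x; elim/hecke_ind: x => x ax0.
rewrite -[LHS]mul1r -tower_sum_hact1 -tower_sum_hact /tower_sum.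
apply: big1 => c _; suff -> : hact x hact1 c = 0.
  by rewrite -[0](scale0r 1) hincl_alg scale0r mul0r.
apply: tfH.
have : hequiv q (HMul (HScal a) x) (HScal 0).
  by apply/hecke_eqP/eqP; rewrite pi_hmul; exact: ax0.
move/hact_hequiv/(congr1 (fun f => f hact1 c)) => /=.
by rewrite hactZ mulr_algl scale0r mul0r.
Qed.

End Tower.

Lemma hecke_torsion_free (R : comNzRingType) (q a : R) n :
  GRing.lreg a -> forall x : hecke q n, a *: x = 0 -> x = 0.
Proof.
move=> a_reg; elim: n => [|n IHn]; last exact: torsion_free_step.
elim/hecke_ind => x.
(* Without generators every expression reduces to a scalar; evaluation in [R] below then tells
   scalars apart. *)
have nf y : hequiv q y (HScal (heval idfun (fun=> q) y) : hterm R 0).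
  elim: y => [b|[i i0]|y IHy z IHz|y IHy z IHz] /=.
  - exact: heq_refl.
  - by lia.
  - by apply: heq_trans (heq_add IHy IHz) _; apply/heq_sym/heq_scalD.
  - by apply: heq_trans (heq_mul IHy IHz) _; apply/heq_sym/heq_scalM.
rewrite (hecke_pi_eq (nf x)) => ax0.
have : hequiv q (HMul (HScal a) (HScal (heval idfun (fun=> q) x)))
                (HScal 0 : hterm R 0).
  by apply/hecke_eqP/eqP; rewrite pi_hmul; exact: ax0.
move/(@heval_hequiv R q 0 R idfun (fun=> q)) => /= ax.
have -> : heval idfun (fun=> q) x = 0.
  apply: a_reg; rewrite mulr0; apply: ax => //.
  - exact: mulrC.
  - by move=> _; rewrite mulrBl mul1r subrK.
by [].
Qed.

(** * The elements R_{n,k} *)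

Local Close Scope quotient_scope.

Section Products.
Variables (R : comNzRingType) (q : R) (n : nat).

Lemma heckeB_shB m : heckeB q n (Posz m) = shB (hT q n) m.
Proof.
rewrite /heckeB; elim: m => [|m IHm]; first by rewrite big_nil.
rewrite big_nat_recr //= [index_iota m.+1 _]/index_iota subnn big_nil addrC.
rewrite -IHm mulr_sumr.
congr (_ + _); apply: eq_big_nat => i im.
rewrite /index_iota subSn; last lia.
rewrite -[(m - i).+1]addn1 iotaD rev_cat big_cat /= big_seq1 subnKC //; lia.
Qed.

Lemma heckeBstar_shBs m : heckeBstar q n (Posz m) = shBs (hT q n) m.
Proof.
rewrite /heckeBstar; elim: m => [|m IHm]; first by rewrite big_nil.
rewrite big_nat_recr //= [X in _ + X]big_geq // addrC -IHm mulr_suml.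
by congr (_ + _); apply: eq_big_nat => i im; rewrite big_nat_recr //; lia.
Qed.

(** The index [m] is separate from [n] because the induction lowers it inside a fixed algebra. *)
Lemma prod_heckeB_shP m k :
  (\prod_(i < k) heckeBstar q n (m%:Z - i%:Z))
  * (\prod_(i < k) heckeB q n (m%:Z - k%:Z + 1 + i%:Z)) = shP (hT q n) m k.
Proof.
elim: k m => [|k IHk] m.
  by rewrite !big_ord0 mulr1.
rewrite big_ord_recl big_ord_recr /=.
rewrite addn0 -/(heckeBstar q n (Posz m)) heckeBstar_shBs.
have -> : m%:Z - k.+1%:Z + 1 + k%:Z = m by lia.
(* For [m = 0] the integer index becomes negative while [m.-1] is truncated; both sides vanish
   through their outer factors. *)
rewrite heckeB_shB; case: m => [|m]; first by rewrite /= !mul0r.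
rewrite -mulrA [X in _ * X]mulrA -IHk !mulrA; congr (_ * _ * _ * _).
  by apply: eq_bigr => i _; congr heckeBstar; rewrite /bump /=; lia.
by apply: eq_bigr => i _; congr heckeB; lia.
Qed.

Lemma heckeBprod_shP k :
  heckeBstarprod q n k * heckeBprod q n k = shP (hT q n) n k.
Proof. exact: prod_heckeB_shP. Qed.

End Products.

Lemma qfact_X_neq0 k : qfact ('X : {poly int}) k != 0.
Proof.
rewrite prodf_seq_neq0; apply/allP => -[|i]; rewrite mem_index_iota // => _ /=.
(* A [q]-integer of positive index has constant term [1]. *)
apply/eqP => /(congr1 (horner^~ 0)).
by rewrite qintS !hornerE => /eqP; rewrite oner_eq0.
Qed.

Lemma heckeRgen_commute n i j :
  GRing.comm (heckeRgen n i) (heckeRgen n j).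
Proof.
pose S k := [set r : hecke ('X : {poly int}) n | qfact 'X k *: r =
  heckeBstarprod 'X n k * heckeBprod 'X n k]%classic.
(* Either the default [0] is taken, which commutes with everything, or the defining equation of the
   quotient holds. *)
have gen k : heckeRgen n k = 0 \/ qfact 'X k *: heckeRgen n k = shP (hT 'X n) n k.
  have [[r rS]|noS] := pselect (exists r, S k r); last first.
    by left; apply: xgetPN => r rS; apply: noS; exists r.
  right; rewrite -heckeBprod_shP.
  exact: (xgetPex 0 (ex_intro _ r rS)).
case: (gen i) => [->|Ei]; first exact/commr_sym/commr0.
case: (gen j) => [->|Ej]; first exact: commr0.
have reg (a : {poly int}) : a != 0 ->
    forall x y : hecke ('X : {poly int}) n, a *: x = a *: y -> x = y.
  move=> a0 x y /eqP; rewrite -subr_eq0 -scalerBr => /eqP.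
  by move/(hecke_torsion_free (mulfI a0))/eqP; rewrite subr_eq0 => /eqP.
have X_reg : GRing.lreg ('X%:A : hecke ('X : {poly int}) n).
  by move=> x y; rewrite !mulr_algl; apply: reg; rewrite polyX_eq0.
(* Torsion-freeness allows both sides to be multiplied by the two [q]-factorials. *)
apply: (reg _ (qfact_X_neq0 i)); apply: (reg _ (qfact_X_neq0 j)).
rewrite (scalerAl _ (heckeRgen n i)) Ei scalerAr Ej.
rewrite (scalerAr _ _ (heckeRgen n i)) Ei scalerAl Ej.
exact: (shP_commute _ _ (hecke_hT_rel _ n) X_reg (leqnn n)).
Qed.

Theorem theorem4p1 (n : nat) (k : fieldType) (q : k) (i j : nat) :
  heckeR q n i * heckeR q n j = heckeR q n j * heckeR q n i.
Proof. by rewrite /heckeR -!rmorphM heckeRgen_commute. Qed.
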